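(* Let $A, B$ be distinct $n\times n$ positive definite complex matrices. Let $\mu_1\ge\cdots\ge\mu_n$ be the eigenvalues of $A^{-1}\sharp B$. (1) For real numbers $t<s$, $$\mu_n^{2s-2t}(A\natural_t B)\preceq A\natural_s B\preceq \mu_1^{2s-2t}(A\natural_t B).$$ (2) For real numbers $t<s$, if one of the following cases occurs: (a) $t,s\in[0,1]$, or (b) $A\preceq B$ or $A\succeq B$, $\mu_1\ne 1$, and $t,s\in\left(\frac{1}{1-\mu_1},\infty\right)$, or (c) $A\preceq B$ or $A\succeq B$, $\mu_n\ne 1$, and $t,s\in\left(-\infty,\frac{1}{1-\mu_n}\right)$, then $$\left(\frac{1-s+s\mu_n}{1-t+t\mu_n}\right)^2(A\diamond_t B)\preceq A\diamond_s B\preceq\left(\frac{1-s+s\mu_1}{1-t+t\mu_1}\right)^2(A\diamond_t B).$$ (3) For $t,s\in\mathbb R$ such that $1-s+s\mu_1>0$ and $1-s+s\mu_n>0$, let $$m_{s,t}=\min\left\{\frac{1-s+s\mu_i}{\mu_i^t}\;\middle|\; 1\le i\le n\right\},\qquad M_{s,t}=\max\left\{\frac{1-s+s\mu_i}{\mu_i^t}\;\middle|\; 1\le i\le n\right\};$$ then $$m_{s,t}^2(A\natural_t B)\preceq A\diamond_s B\preceq M_{s,t}^2(A\natural_t B).$$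
   Context: Positive definite means Hermitian positive definite. For positive definite $A,B$: $A\sharp B = A^{1/2}(A^{-1/2}BA^{-1/2})^{1/2}A^{1/2}$. For all $t\in\mathbb R$, $X\nabla_t Y=(1-t)X+tY$. The spectral geometric mean (extended to all $t\in\mathbb R$) is $A\natural_t B=(A^{-1}\sharp B)^tA(A^{-1}\sharp B)^t$. The Wasserstein mean (extended to all $t\in\mathbb R$) is $A\diamond_t B=(1-t)^2A+t^2B+t(1-t)[(AB)^{1/2}+(BA)^{1/2}]$, where the square roots are those with positive eigenvalues; equivalently $A\diamond_tB=[I\nabla_t(A^{-1}\sharp B)]A[I\nabla_t(A^{-1}\sharp B)]$. The near order $A\preceq B$ on positive definite matrices means $A^{-1}\sharp B\ge I$, where $\ge$ is the Löwner order; $A\succeq B$ means $B\preceq A$. *)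

(* Defs.v *)
From HB Require Import structures.
From mathcomp Require Import all_boot all_order all_algebra.
From mathcomp Require Import complex.
From mathcomp Require Import boolp classical_sets reals exp.

Set Implicit Arguments.
Unset Strict Implicit.
Unset Printing Implicit Defensive.

Import Order.TTheory GRing.Theory Num.Theory.
Local Open Scope ring_scope.
Local Open Scope complex_scope.
Local Open Scope sesquilinear_scope.

Section Means.
Context {R : realType} {n : nat}.
Implicit Types (A B C X Y : 'M[R[i]]_n) (t : R).

(* In the order of R[i], 0 < z and 0 <= z entail that z is real. *)
Definition posdef A : Prop :=
  A \is hermsymmx /\
  forall x : 'cV[R[i]]_n, x != 0 -> 0 < (x^t* *m A *m x) 0 0.

Definition possemidef A : Prop :=
  A \is hermsymmx /\
  forall x : 'cV[R[i]]_n, 0 <= (x^t* *m A *m x) 0 0.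

Definition loewner_le A B : Prop := possemidef (B - A).

(* Real power by spectral calculus; meaningful for positive definite A, where
   A = P^-1 diag(d) P with P = spectralmx A unitary and d = spectral_diag A > 0. *)
Definition mxpowR A t : 'M[R[i]]_n :=
  invmx (spectralmx A)
  *m diag_mx (map_mx (fun z : R[i] => (powR (complex.Re z) t)%:C)
                     (spectral_diag A))
  *m spectralmx A.

(* Square root with positive eigenvalues of a not necessarily Hermitian matrix
   (arbitrary value 0 if there is none). *)
Definition psqrtmx X : 'M[R[i]]_n :=
  xget 0 [set Y : 'M[R[i]]_n |
    Y *m Y = X /\ forall a : R[i], eigenvalue Y a -> 0 < a].

Definition gmean A B : 'M[R[i]]_n :=
  let A12 := mxpowR A (1 / 2%:R) in
  let Am12 := mxpowR A (- (1 / 2%:R)) in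
  A12 *m mxpowR (Am12 *m B *m Am12) (1 / 2%:R) *m A12.

Definition spgmean t A B : 'M[R[i]]_n :=
  let C := gmean (invmx A) B in
  mxpowR C t *m A *m mxpowR C t.

Definition wassmean t A B : 'M[R[i]]_n :=
  ((1 - t) ^+ 2)%:C *: A + (t ^+ 2)%:C *: B
  + (t * (1 - t))%:C *: (psqrtmx (A *m B) + psqrtmx (B *m A)).

(* The near order is a relation between positive definite matrices only. *)
Definition near_le A B : Prop :=
  [/\ posdef A, posdef B & loewner_le 1%:M (gmean (invmx A) B)].

End Means.

(* mu lists the eigenvalues of C, with multiplicity, in nonincreasing order. *)
Definition eigenvalues_desc (R : realType) (n : nat) (C : 'M[R[i]]_n)
    (mu : 'I_n -> R) : Prop :=
  char_poly C = \prod_(i < n) ('X - ((mu i)%:C)%:P) /\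
  forall i j : 'I_n, (i <= j)%N -> mu j <= mu i.

(* Main.v *)
(** Put [C := A^-1 # B], the unique positive definite solution of the Riccati
    equation [C A C = B]. Both means have the form [f(C) A f(C)] for a real
    function [f]: [x^t] for the spectral geometric mean and [1 - t + t x] for the
    Wasserstein mean, because [(AB)^(1/2) = AC] and [(BA)^(1/2) = CA]. If [g / f]
    is positive on the spectrum of [C], then [H := (g / f)(C)] is positive definite
    and maps [X := f(C) A f(C)] to [Y := g(C) A g(C)] by [H X H = Y]; hence
    [X^-1 # Y = H], and [X] is near-below [Y] as soon as [g / f >= 1] on the
    spectrum. Each claim thus reduces to bounding a scalar ratio on
    [[mu_n, mu_1]]. *)

Require Import Defs.
From HB Require Import structures.
From mathcomp Require Import all_boot all_order all_algebra.
From mathcomp Require Import complex ring lra.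
From mathcomp Require Import boolp classical_sets reals exp.

Set Implicit Arguments.
Unset Strict Implicit.
Unset Printing Implicit Defensive.

Import Order.TTheory GRing.Theory Num.Theory.
Local Open Scope ring_scope.
Local Open Scope complex_scope.

(** * Real functional calculus on the spectrum, and positive definiteness *)

Section Calculus.
Context {R : realType} {n : nat}.
Implicit Types (A B C X Y : 'M[R[i]]_n) (f g : R -> R).
Local Open Scope sesquilinear_scope.

Lemma trmxC_mul m p q (M : 'M[R[i]]_(m, p)) (N : 'M[R[i]]_(p, q)) :
  (M *m N)^t* = N^t* *m M^t*.
Proof. by rewrite trmx_mul map_mxM. Qed.

Lemma hermsymmx_trmxC A : A \is hermsymmx <-> A^t* = A.
Proof.
split=> [/is_hermitianmxP|h]; first by rewrite expr0 scale1r => <-.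
by apply/is_hermitianmxP; rewrite expr0 scale1r h.
Qed.

Lemma trmxCK m p (M : 'M[R[i]]_(m, p)) : M^t*^t* = M.
Proof. by rewrite map_trmx trmxK -map_mx_comp (map_mx_id (@conjCK _)). Qed.

Definition spec C (i : 'I_n) : R := complex.Re (spectral_diag C 0 i).

(** Has the shape of [mxpowR] with an arbitrary real function in place of the power, so that real
    powers are instances of it by conversion. *)
Definition mxfun C f : 'M[R[i]]_n :=
  invmx (spectralmx C)
  *m diag_mx (map_mx (fun z : R[i] => (f (complex.Re z))%:C) (spectral_diag C))
  *m spectralmx C.

Lemma mxpowR_mxfun A t : mxpowR A t = mxfun A (fun x => powR x t).
Proof. by []. Qed.

Lemma eq_mxconj (P : 'M[R[i]]_n) (d e : 'rV[R[i]]_n) : d = e ->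
  invmx P *m diag_mx d *m P = invmx P *m diag_mx e *m P.
Proof. by move->. Qed.

Lemma mxfun_mul C f g : mxfun C f *m mxfun C g = mxfun C (fun x => f x * g x).
Proof.
rewrite /mxfun; have := spectral_unit C.
move: (spectralmx C) (spectral_diag C) => P d PU.
have -> M N : invmx P *m M *m P *m (invmx P *m N *m P) =
    invmx P *m (M *m N) *m P by rewrite !mulmxA (mulmxK PU).
rewrite mulmx_diag.
by apply: eq_mxconj; apply/rowP => i; rewrite !mxE rmorphM.
Qed.

Lemma mxfunD C f g : mxfun C f + mxfun C g = mxfun C (fun x => f x + g x).
Proof.
rewrite /mxfun; move: (spectralmx C) (spectral_diag C) => P d.
rewrite -mulmxDl -mulmxDr -(raddfD (@diag_mx _ _)).
by apply: eq_mxconj; apply/rowP => i; rewrite !mxE rmorphD.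
Qed.

Lemma mxfunZ C (k : R) f : k%:C *: mxfun C f = mxfun C (fun x => k * f x).
Proof.
rewrite /mxfun; move: (spectralmx C) (spectral_diag C) => P d.
rewrite scalemxAl scalemxAr -[_ *: diag_mx _]linearZ.
by apply: eq_mxconj; apply/rowP => i; rewrite !mxE rmorphM.
Qed.

Lemma mxfun1 C : mxfun C (fun=> 1) = 1%:M.
Proof.
rewrite /mxfun (_ : map_mx _ _ = const_mx 1) ?diag_const_mx ?mulmx1 ?mulVmx//.
  exact: spectral_unit.
by apply/rowP => i; rewrite !mxE.
Qed.

Lemma eq_mxfun C f g : (forall i, f (spec C i) = g (spec C i)) ->
  mxfun C f = mxfun C g.
Proof.
move=> fg; rewrite /mxfun; apply: eq_mxconj.
by apply/rowP => i; rewrite !mxE; congr (_%:C); exact: fg.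
Qed.

Lemma hermsymmx_spec C i : C \is hermsymmx -> spectral_diag C 0 i = (spec C i)%:C.
Proof.
move=> hC; rewrite RRe_real//.
by have /mxOverP := hermitian_spectral_diag_real hC; apply.
Qed.

Lemma mxfun_id C : C \is hermsymmx -> mxfun C id = C.
Proof.
move=> hC; rewrite [RHS](orthomx_spectralP (hermitian_normalmx hC)).
rewrite /mxfun; apply: eq_mxconj.
by apply/rowP => i; rewrite mxE [RHS]hermsymmx_spec.
Qed.

(** [spectralmx C] is unitary and the diagonal entries are real, hence fixed by conjugation. *)
Lemma trmxC_mxfun C f : (mxfun C f)^t* = mxfun C f.
Proof.
rewrite /mxfun invmx_unitary ?spectral_unitarymx// !trmxC_mul trmxCK mulmxA.
rewrite tr_diag_mx map_diag_mx; apply: (congr1 (fun d => _ *m diag_mx d *m _)).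
by apply/rowP => i; rewrite !mxE; apply/conj_Creal/complex_realP; eexists.
Qed.

Lemma mxfun_herm C f : mxfun C f \is hermsymmx.
Proof. by apply/hermsymmx_trmxC/trmxC_mxfun. Qed.

(** In the coordinates [spectralmx C *m x] the form is diagonal, so the signs of [f] on the spectrum
    decide definiteness. *)
Lemma mxfun_form C f (x : 'cV[R[i]]_n) :
  (x^t* *m mxfun C f *m x) 0 0 =
  \sum_i (f (spec C i))%:C * `|(spectralmx C *m x) i 0| ^+ 2.
Proof.
set y := spectralmx C *m x.
have -> : x^t* *m mxfun C f *m x = y^t* *m diag_mx (map_mx
    (fun z : R[i] => (f (complex.Re z))%:C) (spectral_diag C)) *m y.
  by rewrite trmxC_mul /mxfun invmx_unitary ?spectral_unitarymx// !mulmxA.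
rewrite mxE; apply: eq_bigr => i _.
by rewrite mul_mx_diag !mxE normCKC; ring.
Qed.

Lemma mxfun_possemidef C f : (forall i, 0 <= f (spec C i)) ->
  possemidef (mxfun C f).
Proof.
move=> f0; split=> [|x]; first exact: mxfun_herm.
rewrite mxfun_form sumr_ge0// => i _.
by rewrite mulr_ge0 ?exprn_ge0// (lecR 0).
Qed.

Lemma mxfun_posdef C f : (forall i, 0 < f (spec C i)) -> posdef (mxfun C f).
Proof.
move=> f0; split=> [|x x0]; first exact: mxfun_herm.
rewrite mxfun_form; set y := spectralmx C *m x.
have y0 : y != 0.
  by apply: contraNneq x0 => /(canRL (mulKmx (spectral_unit C))) ->; rewrite mulmx0.
have ge0 i : 0 <= (f (spec C i))%:C * `|y i 0| ^+ 2.
  by rewrite mulr_ge0 ?exprn_ge0// (lecR 0) ltW.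
rewrite lt_neqAle sumr_ge0// andbT eq_sym psumr_eq0//.
apply: contraNN y0 => /allP h; apply/eqP/colP => i; rewrite [RHS]mxE; apply/eqP.
have := h i (mem_index_enum i).
rewrite /= mulf_eq0 sqrf_eq0 normr_eq0 => /orP[/eqP/complexI fi0|//].
by have := f0 i; rewrite fi0 ltxx.
Qed.

Lemma mxfun_eigenvalue C i : C \is hermsymmx -> eigenvalue C (spec C i)%:C.
Proof.
(* Eigenvectors are row vectors, so the rows of the diagonalising matrix serve; a zero row would
   make its determinant vanish. *)
move=> hC; apply/eigenvalueP; exists (row i (spectralmx C)).
  rewrite {2}(orthomx_spectralP (hermitian_normalmx hC)) -row_mul !mulmxA.
  rewrite mulmxV ?spectral_unit// mul1mx mul_diag_mx -hermsymmx_spec//.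
  by apply/rowP => j; rewrite !mxE.
apply/eqP => h; have := spectral_unit C.
rewrite unitmxE (expand_det_row _ i) big1 ?unitr0// => j _.
by have /rowP/(_ j) := h; rewrite !mxE => ->; rewrite mul0r.
Qed.

(** After the change of coordinates [w = v P^-1], the row [w] is an eigenvector of a diagonal
    matrix, and any nonzero coordinate of [w] singles out an entry equal to [a]. *)
Lemma eigenvalue_spec C a : C \is hermsymmx -> eigenvalue C a ->
  exists i, a = (spec C i)%:C.
Proof.
move=> hC /eigenvalueP[v vC v0]; set P := spectralmx C.
have PU : P \in unitmx := spectral_unit C.
pose w := v *m invmx P.
have w0 : w != 0 by apply: contraNneq v0 => /(canRL (mulmxKV PU)) ->; rewrite mul0mx.
have wd : w *m diag_mx (spectral_diag C) = a *: w.
  rewrite /w scalemxAl -vC [in RHS](orthomx_spectralP (hermitian_normalmx hC)).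
  by rewrite !mulmxA mulmxK.
have /rV0Pn[i wi] := w0; exists i.
move/rowP/(_ i): wd; rewrite mul_mx_diag mxE [RHS]mxE hermsymmx_spec// [RHS]mulrC.
by move=> /(mulfI wi) ->.
Qed.

Lemma posdef_rform A (v : 'rV[R[i]]_n) : posdef A -> v != 0 ->
  0 < (v *m A *m v^t*) 0 0.
Proof.
move=> [_ Ap] v0; have /Ap : v^t* != 0.
  by apply: contraNneq v0 => h; rewrite -[v]trmxCK h trmx0 map_mx0.
by rewrite trmxCK.
Qed.

(** If [v A B = a v], the form of [B] at [v A] equals [a] times the form of [A] at [v], and both
    forms are positive. *)
Lemma posdef_mul_eigenvalue A B a : posdef A -> posdef B ->
  eigenvalue (A *m B) a -> 0 < a.
Proof.
move=> pA pB /eigenvalueP[v vAB v0].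
have e : v *m A *m B *m (v *m A)^t* = a *: (v *m A *m v^t*).
  rewrite trmxC_mul (hermsymmx_trmxC _).1; last exact: pA.1.
  by rewrite -[v *m A *m B]mulmxA vAB -!scalemxAl mulmxA.
have vA : v *m A != 0.
  apply/eqP => h; have := posdef_rform pA v0.
  by rewrite h mul0mx mxE ltxx.
have := posdef_rform pB vA; rewrite e mxE pmulr_lgt0//.
exact: posdef_rform.
Qed.

Lemma posdef1 : posdef (1%:M : 'M[R[i]]_n).
Proof. by rewrite -(mxfun1 0); apply: mxfun_posdef => i; rewrite ltr01. Qed.

Lemma posdef_eigenvalue A a : posdef A -> eigenvalue A a -> 0 < a.
Proof.
move=> pA Aa; apply: (posdef_mul_eigenvalue pA posdef1).
by rewrite mulmx1.
Qed.

Lemma posdef_spec_gt0 A i : posdef A -> 0 < spec A i.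
Proof.
by move=> pA; rewrite -ltcR (posdef_eigenvalue pA)// mxfun_eigenvalue//; case: pA.
Qed.

Lemma mxfun_inv C f : (forall i, f (spec C i) != 0) ->
  mxfun C f \in unitmx /\ invmx (mxfun C f) = mxfun C (fun x => (f x)^-1).
Proof.
move=> f0.
have e : mxfun C f *m mxfun C (fun x => (f x)^-1) = 1%:M.
  by rewrite mxfun_mul -(mxfun1 C); apply: eq_mxfun => i; rewrite divff.
have [U _] := mulmx1_unit e; split=> //.
by rewrite -[LHS]mulmx1 -e mulKmx.
Qed.

Lemma posdef_invE A : posdef A ->
  A \in unitmx /\ invmx A = mxfun A (fun x => x^-1).
Proof.
move=> pA; rewrite -{1 2}(mxfun_id pA.1); apply: mxfun_inv => i.
by rewrite gt_eqF// posdef_spec_gt0.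
Qed.

Lemma posdef_inv A : posdef A -> posdef (invmx A).
Proof.
move=> pA; rewrite (posdef_invE pA).2; apply: mxfun_posdef => i.
by rewrite invr_gt0 posdef_spec_gt0.
Qed.

Lemma posdef_congr A X : posdef A -> X \is hermsymmx -> X \in unitmx ->
  posdef (X *m A *m X).
Proof.
move=> [/hermsymmx_trmxC hA pA] /hermsymmx_trmxC hX uX; split=> [|x x0].
  by apply/hermsymmx_trmxC; rewrite !trmxC_mul hA hX mulmxA.
have /pA : X *m x != 0.
  by apply: contraNneq x0 => /(canRL (mulKmx uX)) ->; rewrite mulmx0.
by rewrite trmxC_mul hX !mulmxA.
Qed.

Lemma mxpowR_posdef A t : posdef A -> posdef (mxpowR A t).
Proof.
move=> pA; rewrite mxpowR_mxfun; apply: mxfun_posdef => i.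
by rewrite powR_gt0// posdef_spec_gt0.
Qed.

Lemma mxpowRD A s t : posdef A -> mxpowR A s *m mxpowR A t = mxpowR A (s + t).
Proof.
move=> pA; rewrite !mxpowR_mxfun mxfun_mul; apply: eq_mxfun => i.
by rewrite powRD//; apply/implyP => _; rewrite gt_eqF// posdef_spec_gt0.
Qed.

Lemma mxpowRr0 A : mxpowR A 0 = 1%:M.
Proof.
by rewrite mxpowR_mxfun -(mxfun1 A); apply: eq_mxfun => i; rewrite powRr0.
Qed.

Lemma mxpowRr1 A : posdef A -> mxpowR A 1 = A.
Proof.
move=> pA; rewrite mxpowR_mxfun -[RHS](mxfun_id pA.1); apply: eq_mxfun => i.
by rewrite powRr1// ltW// posdef_spec_gt0.
Qed.

Lemma mxpowR_sqrt A : posdef A ->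
  mxpowR A (1 / 2%:R) *m mxpowR A (1 / 2%:R) = A.
Proof. by move=> pA; rewrite mxpowRD// -splitr mxpowRr1. Qed.

End Calculus.

(** * Positive square roots, the Riccati equation and the near order *)

Section Means.
Local Open Scope sesquilinear_scope.
Context {R : realType} {n : nat}.
Implicit Types (A B C X Y Z : 'M[R[i]]_n.+1).

(* [chi_Z(Y) D = D chi_Z(Z) = 0] by Cayley-Hamilton, and [chi_Z(Y)] is invertible. *)
Lemma sylvester_eq0 (F : closedFieldType) (m : nat) (Y Z D : 'M[F]_m.+1) :
  (forall a, eigenvalue Y a -> ~~ eigenvalue Z a) -> Y *m D = D *m Z -> D = 0.
Proof.
move=> YZ YD; have [rs] := closed_field_poly_normal (char_poly Z).
rewrite (monicP (char_poly_monic Z)) scale1r => chZ.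
have Yrs r : r \in rs -> Y - r%:M \in unitmx.
  move=> rs_r; rewrite -row_free_unit -kermx_eq0.
  apply: contraTT rs_r => rY; rewrite -root_prod_XsubC -chZ -eigenvalue_root_char.
  exact: YZ.
have: D *m horner_mx Z (char_poly Z) = 0 by rewrite Cayley_Hamilton mulmx0.
(* Since [D (Z - r) = (Y - r) D], each linear factor of the characteristic polynomial crosses [D]
   and is cancelled by inverting [Y - r]. *)
rewrite chZ {chZ YZ}; elim: rs Yrs => [_|r rs IH Yrs].
  by rewrite big_nil rmorph1 mulmx1.
rewrite big_cons rmorphM rmorphB /= horner_mx_X horner_mx_C -mulmxE mulmxA.
rewrite mulmxBr -YD mul_mx_scalar -mul_scalar_mx -mulmxBl -mulmxA => h.
apply: IH => [q q_rs|]; first by apply: Yrs; rewrite inE q_rs orbT.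
by rewrite -[LHS](mulKmx (Yrs r (mem_head r rs))) h mulmx0.
Qed.

(** From [Y^2 = Z^2] follows [Y (Y - Z) = (Y - Z) (- Z)], and the spectra of [Y] and [- Z] are
    disjoint because one is positive and the other negative. *)
Lemma pos_sqrt_unique Y Z : Y *m Y = Z *m Z ->
  (forall a, eigenvalue Y a -> 0 < a) -> (forall a, eigenvalue Z a -> 0 < a) ->
  Y = Z.
Proof.
move=> YZ Yp Zp; apply/eqP; rewrite -subr_eq0; apply/eqP.
apply: (@sylvester_eq0 _ _ Y (- Z)) => [a /Yp a0|]; last first.
  by rewrite mulmxN mulmxBr mulmxBl YZ opprB.
apply/negP => /eigenvalueP[v vZ v0].
have /Zp : eigenvalue Z (- a).
  by apply/eigenvalueP; exists v; rewrite // scaleNr -vZ mulmxN opprK.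
by rewrite oppr_gt0 => /(lt_trans a0); rewrite ltxx.
Qed.

Lemma psqrtmx_sqr Y : (forall a, eigenvalue Y a -> 0 < a) ->
  psqrtmx (Y *m Y) = Y.
Proof.
by move=> Yp; apply: xget_unique => // Z [ZY Zp]; exact: pos_sqrt_unique.
Qed.

Lemma mxpowR_half_sqr X : posdef X -> mxpowR (X *m X) (1 / 2%:R) = X.
Proof.
move=> pX; have pXX : posdef (X *m X).
  by rewrite -{1}[X]mulmx1; apply: posdef_congr; [exact: posdef1|exact: pX.1|
     exact: (posdef_invE pX).1].
apply: pos_sqrt_unique; first exact: mxpowR_sqrt.
  by move=> a; apply: posdef_eigenvalue; apply: mxpowR_posdef.
by move=> a; apply: posdef_eigenvalue.
Qed.

(** [S] is A^(-1/2) and [T] is A^(1/2), both written as powers of [invmx A], the form in which they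
    occur in [gmean (invmx A) B]. *)
Lemma mxpowR_halfV A (S := mxpowR (invmx A) (1 / 2%:R))
    (T := mxpowR (invmx A) (- (1 / 2%:R))) : posdef A ->
  [/\ S *m T = 1%:M, T *m S = 1%:M & T *m T = A].
Proof.
move=> pA; have pA' := posdef_inv pA.
have ST : S *m T = 1%:M by rewrite mxpowRD// subrr mxpowRr0.
have TS : T *m S = 1%:M by rewrite mxpowRD// addNr mxpowRr0.
split=> //; have SS : S *m S = invmx A by exact: mxpowR_sqrt.
move: S T ST TS SS => S T ST TS SS.
rewrite -[LHS]mulmx1 -(mulVmx (posdef_invE pA).1) -SS !mulmxA.
by rewrite -[T *m T *m S]mulmxA TS mulmx1 TS mul1mx.
Qed.

(** With [C = S W S] and [W^2 = T B T], replacing [A] by [T T] collapses [C A C] to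
    [S T B T S = B]. *)
Lemma gmean_riccati A B (C := gmean (invmx A) B) : posdef A -> posdef B ->
  posdef C /\ C *m A *m C = B.
Proof.
move=> pA pB; rewrite /C /gmean.
have [] := mxpowR_halfV pA.
have pS : posdef (mxpowR (invmx A) (1 / 2%:R)).
  exact/mxpowR_posdef/posdef_inv.
have pT : posdef (mxpowR (invmx A) (- (1 / 2%:R))).
  exact/mxpowR_posdef/posdef_inv.
set S := mxpowR _ _ in pS *; set T := mxpowR _ (- _) in pT * => ST TS TT.
have pM : posdef (T *m B *m T).
  exact: posdef_congr pB pT.1 (posdef_invE pT).1.
have := mxpowR_posdef (1 / 2%:R) pM; have := mxpowR_sqrt pM.
move: (mxpowR (T *m B *m T) _) => W; move: S T {pM} pS pT ST TS TT => S T.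
move=> pS pT ST TS TT WW pW.
split; first exact: posdef_congr pW pS.1 (posdef_invE pS).1.
transitivity (S *m (W *m ((S *m T) *m (T *m S)) *m W) *m S).
  by rewrite -TT !mulmxA.
by rewrite ST TS !mulmx1 WW !mulmxA ST mul1mx -mulmxA TS mulmx1.
Qed.

(** [T (X A X) T] is the square of the positive definite [T X T], which is therefore its root; the
    outer factors [S] then cancel [T]. *)
Lemma gmean_unique A X : posdef A -> posdef X ->
  gmean (invmx A) (X *m A *m X) = X.
Proof.
move=> pA pX; rewrite /gmean; have [] := mxpowR_halfV pA.
have pT : posdef (mxpowR (invmx A) (- (1 / 2%:R))).
  exact/mxpowR_posdef/posdef_inv.
set S := mxpowR _ _; set T := mxpowR _ (- _) in pT * => ST TS TT.
have -> : T *m (X *m A *m X) *m T = (T *m X *m T) *m (T *m X *m T).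
  by move: T TT {pT ST TS} => T TT; rewrite -TT !mulmxA.
rewrite mxpowR_half_sqr; last exact: posdef_congr pX pT.1 (posdef_invE pT).1.
move: S T {TT pT} ST TS => S T ST TS.
by rewrite !mulmxA ST mul1mx -mulmxA TS mulmx1.
Qed.

(** Signs matter only for the quotient: [f] and [g] may both be negative on the spectrum, as happens
    for the Wasserstein mean outside [[0, 1]]. *)
Lemma near_le_mxfun A C (f g : R -> R) : posdef A ->
  (forall i, f (spec C i) != 0) ->
  (forall i, 1 <= g (spec C i) / f (spec C i)) ->
  near_le (mxfun C f *m A *m mxfun C f) (mxfun C g *m A *m mxfun C g).
Proof.
move=> pA f0 gf.
have pX : posdef (mxfun C f *m A *m mxfun C f).
  exact: posdef_congr pA (mxfun_herm C f) (mxfun_inv f0).1.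
have pH : posdef (mxfun C (fun x => g x / f x)).
  by apply: mxfun_posdef => i; apply: lt_le_trans (gf i).
have HF : mxfun C (fun x => g x / f x) *m mxfun C f = mxfun C g.
  by rewrite mxfun_mul; apply: eq_mxfun => i; rewrite divfK.
have FH : mxfun C f *m mxfun C (fun x => g x / f x) = mxfun C g.
  by rewrite mxfun_mul; apply: eq_mxfun => i; rewrite mulrC divfK.
have H1 : loewner_le 1%:M (mxfun C (fun x => g x / f x)).
  have -> : (1%:M : 'M[R[i]]_n.+1) = mxfun C (fun=> 1) by rewrite mxfun1.
  rewrite /loewner_le -scaleN1r -(rmorphN1 (real_complex R)) mxfunZ mxfunD.
  by apply: mxfun_possemidef => i; rewrite mulr1 subr_ge0.
move: (mxfun C f) (mxfun C g) (mxfun C _) HF FH H1 pX pH => F G H HF FH H1 pX pH.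
have E : G *m A *m G = H *m (F *m A *m F) *m H.
  by rewrite !mulmxA HF -[in RHS]mulmxA FH.
rewrite E; split; [exact: pX| |by rewrite (gmean_unique pX pH)].
exact: posdef_congr pX pH.1 (posdef_invE pH).1.
Qed.

(** At a row eigenvector [v], the form of [C - 1] is [a - 1] times the squared norm of [v]. *)
Lemma loewner_le1_eigenvalue C a : loewner_le 1%:M C -> eigenvalue C a -> 1 <= a.
Proof.
move=> [_ pC] /eigenvalueP[v vC v0].
have := pC (map_mx Num.conj v^T); rewrite trmxCK mulmxBr vC mulmx1.
rewrite -{2}[v]scale1r -scalerBl -scalemxAl mxE.
have v1 := posdef_rform posdef1 v0; rewrite mulmx1 in v1.
by rewrite pmulr_lge0// subr_ge0.
Qed.

Lemma mulmx_congrV C A B : C \in unitmx -> C *m A *m C = B ->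
  A = invmx C *m B *m invmx C.
Proof. by move=> uC <-; rewrite !mulmxA (mulVmx uC) mul1mx (mulmxK uC). Qed.

Lemma near_le_spec_ge1 A B i (C := gmean (invmx A) B) : near_le A B -> 1 <= spec C i.
Proof.
move=> [pA pB /loewner_le1_eigenvalue C1]; rewrite -lecR; apply: C1.
by apply: mxfun_eigenvalue; exact: (gmean_riccati pA pB).1.1.
Qed.

(** Inverting the Riccati equation gives [A = C^-1 B C^-1], so [B^-1 # A = C^-1], whose eigenvalues
    are the inverses of those of [C]. *)
Lemma near_le_spec_le1 A B i (C := gmean (invmx A) B) : near_le B A -> spec C i <= 1.
Proof.
move=> [pB pA /loewner_le1_eigenvalue C1].
have [pC CAC] := gmean_riccati pA pB; rewrite -/C in pC CAC *.
have AE := mulmx_congrV (posdef_invE pC).1 CAC.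
have Ci := gmean_unique pB (posdef_inv pC); rewrite -AE in Ci.
rewrite Ci in C1.
move: C pC {CAC AE Ci} C1 => C pC C1.
have s0 := posdef_spec_gt0 i pC.
rewrite -invf_ge1// -lecR; apply: C1.
have /eigenvalueP[v vC v0] := (mxfun_eigenvalue i pC.1).
apply/eigenvalueP; exists v => //; have CU := (posdef_invE pC).1.
rewrite fmorphV -[in RHS](mulmxK CU v) vC -scalemxAl scalerA mulVf ?scale1r//.
by rewrite gt_eqF// (ltcR 0).
Qed.

Lemma spgmeanE t A B : spgmean t A B =
  mxfun (gmean (invmx A) B) (fun x => powR x t) *m A
  *m mxfun (gmean (invmx A) B) (fun x => powR x t).
Proof. by []. Qed.

Lemma wassmeanE t A B (C := gmean (invmx A) B) : posdef A -> posdef B ->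
  wassmean t A B =
  mxfun C (fun x => 1 - t + t * x) *m A *m mxfun C (fun x => 1 - t + t * x).
Proof.
move=> pA pB; have [pC CAC] := gmean_riccati pA pB; rewrite -/C in pC CAC *.
have -> : mxfun C (fun x => 1 - t + t * x) = (1 - t)%:C%:M + t%:C *: C.
  have -> : t%:C *: C = mxfun C (fun x => t * x) by rewrite -mxfunZ mxfun_id ?pC.1.
  rewrite -scalemx1 -(mxfun1 C) mxfunZ mxfunD.
  by apply: eq_mxfun => i; rewrite mulr1.
move: C pC CAC => C pC <-; rewrite /wassmean.
(* With [B = C A C], both products are squares, of [A C] and of [C A]. As products of two positive
   definite matrices these have positive eigenvalues, so they are the roots selected by
   [psqrtmx]. *)
have -> : A *m (C *m A *m C) = (A *m C) *m (A *m C) by rewrite !mulmxA.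
have -> : C *m A *m C *m A = (C *m A) *m (C *m A) by rewrite !mulmxA.
rewrite !psqrtmx_sqr; first last.
- by move=> a; apply: posdef_mul_eigenvalue.
- by move=> a; apply: posdef_mul_eigenvalue.
rewrite mulmxDl mul_scalar_mx -scalemxAl mulmxDr mul_mx_scalar -scalemxAr.
rewrite mulmxDl -!scalemxAl !scalerDr !scalerA -!rmorphM /= -!expr2 [t * _]mulrC.
set P := _ *: A; set Q := _ *: (C *m A *m C).
set S := _ *: (A *m C); set T := _ *: (C *m A); move: P Q S T => P Q S T.
by rewrite -!addrA; congr (_ + _); rewrite addrC addrAC addrC.
Qed.

(** A constant absorbed into [f] appears on both sides of [A], which is why bounds on the scalar
    ratio enter squared. *)
Lemma near_le_mxfun_between A C (f g : R -> R) (k K : R) : posdef A -> 0 < k ->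
  (forall i, k <= g (spec C i) / f (spec C i) <= K) ->
  near_le ((k ^+ 2)%:C *: (mxfun C f *m A *m mxfun C f))
          (mxfun C g *m A *m mxfun C g) /\
  near_le (mxfun C g *m A *m mxfun C g)
          ((K ^+ 2)%:C *: (mxfun C f *m A *m mxfun C f)).
Proof.
move=> pA k0 kgK.
have scaleE q : (q ^+ 2)%:C *: (mxfun C f *m A *m mxfun C f) =
    mxfun C (fun x => q * f x) *m A *m mxfun C (fun x => q * f x).
  by rewrite -!mxfunZ -scalemxAr -!scalemxAl scalerA -rmorphM.
have gf0 i : 0 < g (spec C i) / f (spec C i).
  by have /andP[/(lt_le_trans k0)] := kgK i.
have f0 i : f (spec C i) != 0.
  by apply: contraTneq (gf0 i) => ->; rewrite invr0 mulr0 ltxx.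
have g0 i : g (spec C i) != 0.
  by apply: contraTneq (gf0 i) => ->; rewrite mul0r ltxx.
(* The lower bound compares [k * f] with [g]; the upper one compares [g] with [K * f]. *)
rewrite !scaleE; split; apply: near_le_mxfun => // i.
- by rewrite mulf_neq0// gt_eqF.
- have /andP[kg _] := kgK i.
  by rewrite invfM mulrCA mulrC ler_pdivlMr// mul1r.
- have /andP[_ gK] := kgK i.
  rewrite -mulrA -[_ / _]invrK invfM invrK [_ * g _]mulrC.
  by rewrite ler_pdivlMr// mul1r.
Qed.

(** Both families enumerate the roots of the characteristic polynomial. They are matched as sets of
    values, which is enough for bounding ratios. *)
Lemma eigenvalues_desc_spec C (mu : 'I_n.+1 -> R) : C \is hermsymmx ->
  eigenvalues_desc C mu ->
  (forall i, exists j, spec C i = mu j) /\ (forall j, exists i, mu j = spec C i).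
Proof.
move=> hC [chC _].
have muP a : eigenvalue C a = (a \in [seq (mu i)%:C | i <- index_enum 'I_n.+1]).
  by rewrite eigenvalue_root_char chC -root_prod_XsubC big_map.
split=> [i|j].
  by have := mxfun_eigenvalue i hC; rewrite muP => /mapP[j _ /complexI ->]; exists j.
have /(eigenvalue_spec hC)[i /complexI ->] : eigenvalue C (mu j)%:C.
  by rewrite muP; apply: map_f; rewrite mem_index_enum.
by exists i.
Qed.

End Means.

(** * Signs of affine functions and monotonicity of their quotients *)

Section Moebius.
Context {R : realType}.
Implicit Types (s t x y : R).

(** The ratio is a Moebius function of determinant [s - t]; the sign condition keeps its pole away
    from the segment between [x] and [y]. *)
Lemma affine_ratio_homo s t x y : t < s -> x <= y ->
  0 < (1 - t + t * x) * (1 - t + t * y) ->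
  (1 - s + s * x) / (1 - t + t * x) <= (1 - s + s * y) / (1 - t + t * y).
Proof.
move=> ts xy D0.
have [x0 y0] : 1 - t + t * x != 0 /\ 1 - t + t * y != 0.
  by split; apply: contraTneq D0 => ->; rewrite ?mul0r ?mulr0 ltxx.
rewrite -subr_ge0.
have -> : (1 - s + s * y) / (1 - t + t * y) - (1 - s + s * x) / (1 - t + t * x)
    = (s - t) * (y - x) / ((1 - t + t * x) * (1 - t + t * y)).
  by field; rewrite x0 y0.
by rewrite divr_ge0 ?(ltW D0)// mulr_ge0 ?subr_ge0// ltW.
Qed.

Lemma affine_ratio_between s t x a b : t < s ->
  (forall z, a <= z <= b -> 0 < 1 - t + t * z /\ 0 < 1 - s + s * z) \/
  (forall z, a <= z <= b -> 1 - t + t * z < 0 /\ 1 - s + s * z < 0) ->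
  a <= x -> x <= b ->
  [/\ 0 < (1 - s + s * a) / (1 - t + t * a),
      (1 - s + s * a) / (1 - t + t * a) <= (1 - s + s * x) / (1 - t + t * x)
    & (1 - s + s * x) / (1 - t + t * x) <= (1 - s + s * b) / (1 - t + t * b)].
Proof.
move=> ts sgn ax xb; have ab := le_trans ax xb.
have [aI xI bI] : [/\ a <= a <= b, a <= x <= b & a <= b <= b].
  by rewrite !lexx ax xb ab.
case: sgn => sgn; have [ta sa] := sgn _ aI; have [tx _] := sgn _ xI;
  have [tb _] := sgn _ bI.
  by split; [rewrite divr_gt0|apply: affine_ratio_homo; rewrite ?mulr_gt0
    |apply: affine_ratio_homo; rewrite ?mulr_gt0].
by split; [rewrite nmulr_rgt0 ?invr_lt0|apply: affine_ratio_homo; rewrite ?nmulr_rgt0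
  |apply: affine_ratio_homo; rewrite ?nmulr_rgt0].
Qed.

Lemma affine_gt0_unit t x : t \in `[0, 1] -> 0 < x -> 0 < 1 - t + t * x.
Proof. by rewrite in_itv /= => /andP[t0 t1] x0; nra. Qed.

(** The affine function equals 1 at 1, so positivity at [y] extends to all points between 1 and
    [y]. *)
Lemma affine_gt0_between1 t x y : 0 < 1 - t + t * y ->
  1 <= x <= y \/ y <= x <= 1 -> 0 < 1 - t + t * x.
Proof.
by move=> y0 [] /andP[h1 h2]; have [t0|t0] := leP 0 t; nra.
Qed.

(** Being 1 at 1 and negative at [y], the affine function stays negative beyond [y]. *)
Lemma affine_lt0_beyond1 t x y : 1 - t + t * y < 0 ->
  1 <= y <= x \/ x <= y <= 1 -> 1 - t + t * x < 0.
Proof.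
by move=> y0 [] /andP[h1 h2]; have [t0|t0] := leP 0 t; nra.
Qed.

End Moebius.

Theorem theorem3p7 (R : realType) (n : nat) (A B : 'M[R[i]]_n.+1)
    (mu : 'I_n.+1 -> R)
    (hA : posdef A) (hB : posdef B) (hAB : A <> B)
    (hmu : eigenvalues_desc (gmean (invmx A) B) mu) :
  let mu1 := mu ord0 in
  let mun := mu ord_max in
  [/\ forall t s : R, t < s ->
        near_le ((powR mun (2%:R * s - 2%:R * t))%:C *: spgmean t A B)
                (spgmean s A B) /\
        near_le (spgmean s A B)
                ((powR mu1 (2%:R * s - 2%:R * t))%:C *: spgmean t A B),
      forall t s : R, t < s ->
        [\/ t \in `[0, 1] /\ s \in `[0, 1],
            [/\ near_le A B \/ near_le B A, mu1 <> 1,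
                t \in `]1 / (1 - mu1), +oo[ & s \in `]1 / (1 - mu1), +oo[]
          | [/\ near_le A B \/ near_le B A, mun <> 1,
                t \in `]-oo, 1 / (1 - mun)[ & s \in `]-oo, 1 / (1 - mun)[]] ->
        near_le
          ((((1 - s + s * mun) / (1 - t + t * mun)) ^+ 2)%:C *: wassmean t A B)
          (wassmean s A B) /\
        near_le
          (wassmean s A B)
          ((((1 - s + s * mu1) / (1 - t + t * mu1)) ^+ 2)%:C *: wassmean t A B)
    & forall t s : R,
        0 < 1 - s + s * mu1 -> 0 < 1 - s + s * mun ->
        let ratio := fun i : 'I_n.+1 => (1 - s + s * mu i) / powR (mu i) t in
        let m := \big[Num.min/ratio ord0]_(i < n.+1) ratio i in
        let M := \big[Num.max/ratio ord0]_(i < n.+1) ratio i in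
        near_le ((m ^+ 2)%:C *: spgmean t A B) (wassmean s A B) /\
        near_le (wassmean s A B) ((M ^+ 2)%:C *: spgmean t A B)].
Proof.
move=> mu1 mun; have [pC _] := gmean_riccati hA hB.
have [spec_mu mu_spec] := eigenvalues_desc_spec pC.1 hmu.
have le_mu : forall i j : 'I_n.+1, (i <= j)%N -> mu j <= mu i := hmu.2.
have spgE t := @spgmeanE _ _ t A B; have wasE t := wassmeanE t hA hB.
have ge1 i : near_le A B -> 1 <= spec (gmean (invmx A) B) i :=
  @near_le_spec_ge1 _ _ A B i.
have le1 i : near_le B A -> spec (gmean (invmx A) B) i <= 1 :=
  @near_le_spec_le1 _ _ A B i.
move: (gmean (invmx A) B) pC spec_mu mu_spec spgE wasE ge1 le1
  => C pC spec_mu mu_spec spgE wasE ge1 le1 {hmu}.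
have mu_gt0 j : 0 < mu j by have [i ->] := mu_spec j; exact: posdef_spec_gt0.
have mu_ge1 j : near_le A B -> 1 <= mu j by have [i ->] := mu_spec j; exact: ge1.
have mu_le1 j : near_le B A -> mu j <= 1 by have [i ->] := mu_spec j; exact: le1.
have mun_le i : mun <= spec C i by have [j ->] := spec_mu i; rewrite le_mu// leq_ord.
have le_mu1 i : spec C i <= mu1 by have [j ->] := spec_mu i; rewrite le_mu.
have mun0 : 0 < mun := mu_gt0 _; have mu10 : 0 < mu1 := mu_gt0 _.
split=> [t s ts|t s ts cases|t s s1 sn ratio m M].
(* The ratio is [x^(s - t)], nondecreasing in [x > 0] because [t < s]; its square carries the
   exponent [2s - 2t]. *)
- have sq k : 0 < k -> powR k (2%:R * s - 2%:R * t) = powR k (s - t) ^+ 2.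
    move=> k0; rewrite -mulrBr mulrC powRrM powR_mulrn//; exact: powR_ge0.
  rewrite (sq _ mun0) (sq _ mu10) (spgE t) (spgE s).
  apply: (near_le_mxfun_between hA) => [|i]; first exact: powR_gt0.
  have x0 := posdef_spec_gt0 i pC.
  rewrite -powRB ?(gt_eqF x0) ?implybT//.
  by rewrite !ge0_ler_powR ?nnegrE ?subr_ge0 ?mun_le ?le_mu1 ?ltW.
- rewrite (wasE t) (wasE s).
  have sgn : (forall z, mun <= z <= mu1 -> 0 < 1 - t + t * z /\ 0 < 1 - s + s * z) \/
      (forall z, mun <= z <= mu1 -> 1 - t + t * z < 0 /\ 1 - s + s * z < 0).
    (* This form shows the sign change in [u] at [1 / (1 - x)], the source of the interval endpoints
       in the hypotheses. *)
    have affE (u x : R) : 1 - u + u * x = 1 - u * (1 - x) by ring.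
    case: cases => [[t01 s01]|[near mu1N1]|[near munN1]].
    + left=> z /andP[/(lt_le_trans mun0) z0 _].
      by split; exact: affine_gt0_unit.
    (* If [A] is near-below [B], the spectrum lies in [[1, mu1]]: positivity at [mu1] spreads down
       towards 1. *)
    + rewrite !in_itv /= !andbT => tI sI; case: near => near.
        have mu1_gt1 : 1 < mu1.
          by rewrite lt_neqAle eq_sym mu_ge1 // andbT; exact/eqP.
        have pos u : 1 / (1 - mu1) < u -> 0 < 1 - u + u * mu1.
          by rewrite ltr_ndivrMr ?subr_lt0// affE subr_gt0.
        left=> z /andP[nz z1].
        have zb : 1 <= z <= mu1 by rewrite z1 (le_trans (mu_ge1 _ near) nz).
        by split; apply: affine_gt0_between1 (or_introl zb); exact: pos.
      (* Here the whole spectrum lies below 1, with [mu1] nearest to it: both affine functions are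
         negative at [mu1], hence at all smaller points. *)
      have mu1_lt1 : mu1 < 1 by rewrite lt_neqAle mu_le1 // andbT; exact/eqP.
      have neg u : 1 / (1 - mu1) < u -> 1 - u + u * mu1 < 0.
        by rewrite ltr_pdivrMr ?subr_gt0// affE subr_lt0.
      right=> z /andP[nz z1].
      have zb : z <= mu1 <= 1 by rewrite z1 ltW.
      by split; apply: affine_lt0_beyond1 (or_intror zb); exact: neg.
    (* The mirror image at [mun]: negative from [mun] upwards if [mun > 1], positive between [mun]
       and 1 if [mun < 1]. *)
    + rewrite !in_itv /= => tI sI; case: near => near.
        have mun_gt1 : 1 < mun.
          by rewrite lt_neqAle eq_sym mu_ge1 // andbT; exact/eqP.
        have neg u : u < 1 / (1 - mun) -> 1 - u + u * mun < 0.
          by rewrite ltr_ndivlMr ?subr_lt0// affE subr_lt0.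
        right=> z /andP[nz z1].
        have zb : 1 <= mun <= z by rewrite nz ltW.
        by split; apply: affine_lt0_beyond1 (or_introl zb); exact: neg.
      have mun_lt1 : mun < 1 by rewrite lt_neqAle mu_le1 // andbT; exact/eqP.
      have pos u : u < 1 / (1 - mun) -> 0 < 1 - u + u * mun.
        by rewrite ltr_pdivlMr ?subr_gt0// affE subr_gt0.
      left=> z /andP[nz z1].
      have zb : mun <= z <= 1 by rewrite nz (le_trans z1 (mu_le1 _ near)).
      by split; apply: affine_gt0_between1 (or_intror zb); exact: pos.
  have between i := affine_ratio_between ts sgn (mun_le i) (le_mu1 i).
  apply: (near_le_mxfun_between hA) => [|i].
    by have [] := between ord0.
  by have [_ -> ->] := between i.
- rewrite (spgE t) (wasE s).
  (* An affine function positive at [mun] and [mu1] is positive at every eigenvalue between them. *)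
  have ratio_gt0 j : 0 < ratio j.
    have jn : mun <= mu j by rewrite le_mu// leq_ord.
    have j1 : mu j <= mu1 by rewrite le_mu.
    rewrite divr_gt0 ?powR_gt0//.
    by have [s0|s0] := leP 0 s; nra.
  (* The initial value [ratio ord0] is one of the ratios, so it is positive like the others, and so
     is [m]. *)
  apply: (near_le_mxfun_between hA) => [|i]; first exact: lt_bigmin.
  have [j ->] := spec_mu i.
  by rewrite (bigmin_le _ j ratio) (le_bigmax _ ratio j).
Qed.
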